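(* (The Binomial Transfer Principle.) Let $p$ and $q$ be binomial polynomials in variables $x_1,\dots,x_k$. If the identity $p(a_1,\dots,a_k)=q(a_1,\dots,a_k)$ holds for all $a_1,\dots,a_k\in\mathbb{Z}$, then for every binomial ring $R$ the identity $p(r_1,\dots,r_k)=q(r_1,\dots,r_k)$ holds for all $r_1,\dots,r_k\in R$.
   Context: A commutative ring $R$ with unity is a binomial ring if it is torsion-free as a $\mathbb{Z}$-module and, regarded as a subring of $\mathbb{Q}\otimes_{\mathbb{Z}} R$, is closed under the operations $r\mapsto \binom{r}{n}=\frac{r(r-1)\cdots(r-n+1)}{n!}$ for all $n\in\mathbb{N}=\{0,1,2,\dots\}$. A binomial polynomial in the variables $x_1,\dots,x_k$ is a finite expression $\sum_{n_1,\dots,n_k=0}^{m} c_{n_1,\ldots,n_k}\binom{x_1}{n_1}\cdots\binom{x_k}{n_k}$ with $m\in\mathbb{N}$ and $c_{n_1,\ldots,n_k}\in\mathbb{Z}$; it is evaluated at elements of a binomial ring by means of the binomial coefficients of that ring. *)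

(* Defs.v *)
From HB Require Import structures.
From mathcomp Require Import all_boot all_order all_algebra.
From mathcomp Require Import boolp.
From mathcomp Require Import ring.

Set Implicit Arguments.
Unset Strict Implicit.
Unset Printing Implicit Defensive.

Import Order.TTheory GRing.Theory Num.Theory.
Local Open Scope ring_scope.
Local Open Scope quotient_scope.

(* The ring Q (x)_Z R, for an arbitrary commutative ring R (possibly with
   torsion, possibly zero).  Since every element of it is a pure tensor
   (1 / d) (x) r, it is built from the pairs (r, n), where (r, n) stands for
   (1 / n.+1) (x) r.  That the result is the tensor product of the Z-modules
   Q and R, with the usual multiplication, is proved below:
   [tens_biadditive], [tens_universal], [tensM]. *)
Section RatTensor.
Variable R : comPzRingType.

Definition tens_rel (x y : R * nat) : bool :=
  `[< exists k : nat, x.1 *+ (y.2.+1 * k.+1) = y.1 *+ (x.2.+1 * k.+1) >].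

Lemma tens_rel_refl : reflexive tens_rel.
Proof. by move=> x; apply/asboolP; exists 0%N. Qed.

Lemma tens_rel_sym : symmetric tens_rel.
Proof. by move=> x y; apply/asboolP/asboolP => -[k e]; exists k. Qed.

Lemma tens_rel_trans : transitive tens_rel.
Proof.
move=> [s e] [r d] [t f] /asboolP[/= k h1] /asboolP[/= l h2].
have [m mE] : exists m, m.+1 = (e.+1 * k.+1 * l.+1)%N.
  by exists (e.+1 * k.+1 * l.+1).-1; rewrite prednK ?muln_gt0.
apply/asboolP; exists m; rewrite mE /=.
have -> : (f.+1 * (e.+1 * k.+1 * l.+1) = (e.+1 * k.+1) * (f.+1 * l.+1))%N.
  by ring.
have -> : (d.+1 * (e.+1 * k.+1 * l.+1) = (e.+1 * l.+1) * (d.+1 * k.+1))%N.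
  by ring.
by rewrite mulrnA h1 mulrnAC h2 -mulrnA.
Qed.

Canonical tens_rel_equiv :=
  EquivRel tens_rel tens_rel_refl tens_rel_sym tens_rel_trans.

Definition ratTensor := {eq_quot tens_rel}.
HB.instance Definition _ : EqQuotient _ tens_rel ratTensor :=
  EqQuotient.on ratTensor.
HB.instance Definition _ := Choice.on ratTensor.

(* (1 / d) (x) r, for d > 0 *)
Definition tmk (r : R) (d : nat) : ratTensor := \pi_ratTensor (r, d.-1).

Lemma tmkP r d s e : (0 < d)%N -> (0 < e)%N ->
  (exists2 k, (0 < k)%N & r *+ (e * k) = s *+ (d * k)) <->
  tmk r d = tmk s e.
Proof.
move=> d0 e0; split=> [[k k0 h]|/eqmodP/asboolP[k /=]].
  by apply/eqmodP/asboolP; exists k.-1; rewrite /= !prednK.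
by rewrite !prednK // => h; exists k.+1.
Qed.

Lemma eq_tmk r d s e : (0 < d)%N -> (0 < e)%N ->
  r *+ e = s *+ d -> tmk r d = tmk s e.
Proof. by move=> d0 e0 h; apply/tmkP => //; exists 1%N; rewrite // !muln1. Qed.

Definition tnum (x : ratTensor) : R := (repr x).1.
Definition tden (x : ratTensor) : nat := (repr x).2.+1.

Lemma tmk_numden x : tmk (tnum x) (tden x) = x.
Proof. by rewrite /tmk /tnum /tden /= -surjective_pairing reprK. Qed.

Lemma tmkW (P : ratTensor -> Prop) :
  (forall r d, (0 < d)%N -> P (tmk r d)) -> forall x, P x.
Proof. by move=> h x; rewrite -(tmk_numden x); apply: h. Qed.

Lemma tnumdenP r d : (0 < d)%N ->
  exists2 k, (0 < k)%N & tnum (tmk r d) *+ (d * k) = r *+ (tden (tmk r d) * k).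
Proof. by move=> d0; apply/tmkP => //; rewrite tmk_numden. Qed.

Definition tadd x y :=
  tmk (tnum x *+ tden y + tnum y *+ tden x) (tden x * tden y).
Definition topp x := tmk (- tnum x) (tden x).
Definition tmul x y := tmk (tnum x * tnum y) (tden x * tden y).
Definition tscale (q : rat) x :=
  tmk (tnum x *~ numq q) (tden x * `|denq q|).

Lemma taddE r d s e : (0 < d)%N -> (0 < e)%N ->
  tadd (tmk r d) (tmk s e) = tmk (r *+ e + s *+ d) (d * e).
Proof.
move=> d0 e0; have [k k0 hk] := tnumdenP r d0; have [l l0 hl] := tnumdenP s e0.
rewrite /tadd; move: hk hl; set a := tnum _; set b := tden _.
set a' := tnum _; set b' := tden _ => hk hl.
apply/tmkP; rewrite ?muln_gt0 ?d0 ?e0 //; exists (k * l)%N; first by rewrite muln_gt0 k0.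
rewrite !mulrnDl -!mulrnA; congr (_ + _).
- have -> : (b' * (d * e * (k * l)) = (d * k) * (b' * e * l))%N by ring.
  by rewrite mulrnA hk -mulrnA; congr (_ *+ _); ring.
- have -> : (b * (d * e * (k * l)) = (e * l) * (b * d * k))%N by ring.
  by rewrite mulrnA hl -mulrnA; congr (_ *+ _); ring.
Qed.

Lemma toppE r d : (0 < d)%N -> topp (tmk r d) = tmk (- r) d.
Proof.
move=> d0; have [k k0 hk] := tnumdenP r d0.
by apply/tmkP => //; exists k => //; rewrite !mulNrn hk.
Qed.

Lemma tmulE r d s e : (0 < d)%N -> (0 < e)%N ->
  tmul (tmk r d) (tmk s e) = tmk (r * s) (d * e).
Proof.
move=> d0 e0; have [k k0 hk] := tnumdenP r d0; have [l l0 hl] := tnumdenP s e0.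
rewrite /tmul; move: hk hl; set a := tnum _; set b := tden _.
set a' := tnum _; set b' := tden _ => hk hl.
apply/tmkP; rewrite ?muln_gt0 ?d0 ?e0 //; exists (k * l)%N; first by rewrite muln_gt0 k0.
have -> : (d * e * (k * l) = (d * k) * (e * l))%N by ring.
have -> : (b * b' * (k * l) = (b * k) * (b' * l))%N by ring.
by rewrite mulrnA -mulrnAl hk -mulrnAr hl mulrnAr mulrnAl -mulrnA.
Qed.

Lemma tscaleE q n c r d : (0 < d)%N -> (0 < c)%N -> q = n%:~R / c%:R ->
  tscale q (tmk r d) = tmk (r *~ n) (d * c).
Proof.
move=> d0 c0 qE; have [k k0 hk] := tnumdenP r d0.
have dq0 : (0 < `|denq q|)%N by rewrite absz_gt0.
have nE : numq q * c%:Z = n * denq q.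
  apply/(@intr_inj rat); rewrite !intrM -pmulrn.
  have cn0 : c%:R != 0 :> rat by rewrite pnatr_eq0 -lt0n.
  have -> : n%:~R = q * c%:R by rewrite qE divfK.
  by rewrite numqE mulrAC.
rewrite /tscale; move: hk; set a := tnum _; set b := tden _ => hk.
apply/tmkP; rewrite ?muln_gt0 ?d0 ?c0 ?dq0 //; exists k => //.
rewrite !pmulrn -!mulrzA !PoszM.
have -> : numq q * (Posz d * Posz c * Posz k) =
          Posz (d * k)%N * (numq q * c%:Z) by rewrite PoszM; ring.
rewrite mulrzA -pmulrn hk nE pmulrn -mulrzA PoszM.
by congr (_ *~ _); rewrite absz_denq; ring.
Qed.

Lemma taddA : associative tadd.
Proof.
elim/tmkW => r d d0; elim/tmkW => s e e0; elim/tmkW => t f f0.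
rewrite !taddE ?muln_gt0 ?d0 ?e0 // mulnA; congr tmk.
by rewrite !mulrnDl -!mulrnA addrA [(f * d)%N]mulnC [(e * d)%N]mulnC.
Qed.

Lemma taddC : commutative tadd.
Proof.
by elim/tmkW => r d d0; elim/tmkW => s e e0; rewrite !taddE // addrC mulnC.
Qed.

Lemma tadd0 : left_id (tmk 0 1) tadd.
Proof. by elim/tmkW => r d d0; rewrite taddE // mul0rn add0r mulr1n mul1n. Qed.

Lemma taddN : left_inverse (tmk 0 1) topp tadd.
Proof.
elim/tmkW => r d d0; rewrite toppE // taddE // mulNrn addNr.
by apply: eq_tmk; rewrite ?muln_gt0 ?d0 // !mul0rn.
Qed.

HB.instance Definition _ :=
  GRing.isZmodule.Build ratTensor taddA taddC tadd0 taddN.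

Lemma tmkD r d s e : (0 < d)%N -> (0 < e)%N ->
  tmk r d + tmk s e = tmk (r *+ e + s *+ d) (d * e).
Proof. exact: taddE. Qed.

Lemma tmkN r d : (0 < d)%N -> - tmk r d = tmk (- r) d.
Proof. exact: toppE. Qed.

Lemma tmulA : associative tmul.
Proof.
elim/tmkW => r d d0; elim/tmkW => s e e0; elim/tmkW => t f f0.
by rewrite !tmulE ?muln_gt0 ?d0 ?e0 // mulnA mulrA.
Qed.

Lemma tmulC : commutative tmul.
Proof.
by elim/tmkW => r d d0; elim/tmkW => s e e0; rewrite !tmulE // mulrC mulnC.
Qed.

Lemma tmul1 : left_id (tmk 1 1) tmul.
Proof. by elim/tmkW => r d d0; rewrite tmulE // mul1r mul1n. Qed.

Lemma tmulDl : left_distributive tmul tadd.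
Proof.
elim/tmkW => r d d0; elim/tmkW => s e e0; elim/tmkW => t f f0.
rewrite !(taddE, tmulE) ?muln_gt0 ?d0 ?e0 ?f0 //.
apply: eq_tmk; rewrite ?muln_gt0 ?d0 ?e0 ?f0 //.
rewrite mulrDl !mulrnDl !(mulrnAl, mulrnAr) -!mulrnA.
by congr (_ *+ _ + _ *+ _); ring.
Qed.

HB.instance Definition _ := GRing.Zmodule_isComPzRing.Build ratTensor
  tmulA tmulC tmul1 tmulDl.

Lemma tmkM r d s e : (0 < d)%N -> (0 < e)%N ->
  tmk r d * tmk s e = tmk (r * s) (d * e).
Proof. exact: tmulE. Qed.

Lemma rat_fracP (q : rat) :
  exists n : int, exists2 c, (0 < c)%N & q = n%:~R / c%:R.
Proof.
exists (numq q), `|denq q|%N; first by rewrite absz_gt0.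
by rewrite -{1}(divq_num_den q) pmulrn absz_denq.
Qed.

Lemma tscaleA p q x : tscale p (tscale q x) = tscale (p * q) x.
Proof.
have [m [b b0 pE]] := rat_fracP p; have [n [c c0 qE]] := rat_fracP q.
elim/tmkW: x => r d d0.
rewrite (tscaleE r d0 c0 qE) (tscaleE _ _ b0 pE) ?muln_gt0 ?d0 //.
rewrite (@tscaleE (p * q) (n * m) (c * b)) ?muln_gt0 ?c0 //.
  by rewrite -mulrzA mulnA.
by rewrite pE qE mulf_div [n * m]mulrC [(c * b)%N]mulnC intrM natrM.
Qed.

Lemma tscale1 : left_id 1 tscale.
Proof.
elim/tmkW => r d d0; rewrite (@tscaleE 1 1 1%N) // ?mulr1z ?muln1 //.
Qed.

Lemma tscaleDr : right_distributive tscale +%R.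
Proof.
move=> q; have [n [c c0 qE]] := rat_fracP q.
elim/tmkW => r d d0; elim/tmkW => s e e0; rewrite tmkD //.
rewrite !(tscaleE _ _ c0 qE) // ?tmkD ?muln_gt0 ?d0 ?e0 //.
apply: eq_tmk; rewrite ?muln_gt0 ?d0 ?e0 ?c0 //.
rewrite mulrzDl !mulrnDl !pmulrn -!mulrzA.
by congr (_ *~ _ + _ *~ _); rewrite !PoszM; ring.
Qed.

Lemma tscaleDl x : {morph tscale^~ x : p q / p + q}.
Proof.
move=> p q.
have [m [b b0 pE]] := rat_fracP p; have [n [c c0 qE]] := rat_fracP q.
elim/tmkW: x => r d d0.
rewrite (tscaleE r d0 c0 qE) (tscaleE r d0 b0 pE).
rewrite (@tscaleE (p + q) (m * c%:Z + n * b%:Z) (b * c)) ?muln_gt0 ?b0 //.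
  rewrite tmkD ?muln_gt0 ?d0 //; apply: eq_tmk; rewrite ?muln_gt0 ?d0 ?b0 ?c0 //.
  rewrite !pmulrn -!mulrzA -!mulrzDr -!mulrzA.
  by congr (_ *~ _); rewrite !PoszM; ring.
rewrite pE qE addf_div ?pnatr_eq0 -?lt0n // natrM intrD !intrM.
by rewrite -!pmulrn.
Qed.

HB.instance Definition _ := GRing.Zmodule_isLmodule.Build rat ratTensor
  tscaleA tscale1 tscaleDr tscaleDl.

Lemma tmkZ q n c r d : (0 < d)%N -> (0 < c)%N -> q = n%:~R / c%:R ->
  q *: tmk r d = tmk (r *~ n) (d * c).
Proof. exact: tscaleE. Qed.

(* The canonical ring morphism R -> Q (x) R, r |-> 1 (x) r *)
Definition ratTensor_of (r : R) : ratTensor := tmk r 1.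

Lemma ratTensor_of_is_zmod_morphism : zmod_morphism ratTensor_of.
Proof.
by move=> r s; rewrite /ratTensor_of tmkN // tmkD.
Qed.
HB.instance Definition _ := GRing.isZmodMorphism.Build R ratTensor
  ratTensor_of ratTensor_of_is_zmod_morphism.

Lemma ratTensor_of_is_monoid_morphism : monoid_morphism ratTensor_of.
Proof. by split=> // r s; rewrite /ratTensor_of tmkM. Qed.
HB.instance Definition _ := GRing.isMonoidMorphism.Build R ratTensor
  ratTensor_of ratTensor_of_is_monoid_morphism.

Definition tens (q : rat) (r : R) : ratTensor := q *: ratTensor_of r.

Lemma tens_biadditive :
  (forall r, zmod_morphism (tens^~ r)) /\ (forall q, zmod_morphism (tens q)).
Proof.
split=> [r p q | q r s]; rewrite /tens; first by rewrite scalerBl.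
by rewrite raddfB scalerBr.
Qed.

Lemma tmk_tens r d : (0 < d)%N -> tmk r d = tens d%:R^-1 r.
Proof.
move=> d0; rewrite /tens /ratTensor_of.
by rewrite (@tmkZ _ 1 d) ?mul1r ?mulr1z ?mul1n.
Qed.

Lemma tens_universal (V : zmodType) (f : rat -> R -> V) :
  (forall r, zmod_morphism (f^~ r)) -> (forall q, zmod_morphism (f q)) ->
  exists! g : ratTensor -> V,
    zmod_morphism g /\ forall q r, g (tens q r) = f q r.
Proof.
move=> fl fr.
pose Ml r := GRing.isZmodMorphism.Build _ _ (f^~ r) (fl r).
pose Mr q := GRing.isZmodMorphism.Build _ _ (f q) (fr q).
pose FL r : {additive rat -> V} := HB.pack (f^~ r) (Ml r).
pose FR q : {additive R -> V} := HB.pack (f q) (Mr q).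
have fMl r q n : f (q *+ n) r = f q r *+ n by exact: (raddfMn (FL r)).
have fMr q r n : f q (r *+ n) = f q r *+ n by exact: (raddfMn (FR q)).
have fZl r q n : f (q *~ n) r = f q r *~ n by exact: (raddfMz (FL r)).
have fZr q r n : f q (r *~ n) = f q r *~ n by exact: (raddfMz (FR q)).
have fD q r s : f q (r + s) = f q r + f q s by exact: (raddfD (FR q)).
have fN q r : f q (- r) = - f q r by exact: (raddfN (FR q)).
have spl (r : R) (d k : nat) : (0 < d)%N -> (0 < k)%N ->
    f d%:R^-1 r = f (d * k)%:R^-1 (r *+ k).
  move=> d0 k0; rewrite fMr -fMl; congr (f _ r).
  rewrite -[RHS]mulr_natr natrM invfM -mulrA mulVf ?mulr1 //.
  by rewrite pnatr_eq0 -lt0n.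
pose g x := f (tden x)%:R^-1 (tnum x).
have gE r d : (0 < d)%N -> g (tmk r d) = f d%:R^-1 r.
  move=> d0; have [k k0 hk] := tnumdenP r d0.
  rewrite /g; move: hk; set a := tnum _.
  have : (0 < tden (tmk r d))%N by [].
  set b := tden _ => b0 hk.
  rewrite (spl a b (d * k)%N) ?muln_gt0 ?d0 // hk.
  rewrite (spl r d (b * k)%N) ?muln_gt0 ?b0 //.
  by congr (f _%:R^-1 _); ring.
exists g; split; [split|].
- elim/tmkW => r d d0; elim/tmkW => s e e0.
  rewrite tmkN // tmkD // !gE ?muln_gt0 ?d0 //.
  rewrite fD mulNrn fN; congr (_ - _); first by rewrite -spl.
  by rewrite mulnC -spl.
- move=> q r; have [n [c c0 qE]] := rat_fracP q.
  rewrite /tens /ratTensor_of (@tmkZ _ n c) // mul1n gE //.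
  by rewrite fZr -fZl qE; congr (f _ r); rewrite -mulrzl.
- move=> h [_ hE]; apply/funext; elim/tmkW => r d d0.
  by rewrite gE // tmk_tens // hE.
Qed.

Lemma tensM p q r s : tens p r * tens q s = tens (p * q) (r * s).
Proof.
have [m [b b0 pE]] := rat_fracP p; have [n [c c0 qE]] := rat_fracP q.
rewrite /tens /ratTensor_of.
rewrite (@tmkZ p m b) // (@tmkZ q n c) // !mul1n tmkM //.
rewrite (@tmkZ (p * q) (m * n) (b * c)) ?muln_gt0 ?b0 // ?mul1n.
  by rewrite mulrzAl mulrzAr [m * n]mulrC mulrzA.
by rewrite pE qE mulf_div intrM natrM.
Qed.

(* x (x - 1) ... (x - n + 1) / n!, computed in Q (x) R *)
Definition ratTensor_binom (x : ratTensor) (n : nat) : ratTensor :=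
  (n`!%:R^-1 : rat) *: \prod_(i < n) (x - i%:R).

End RatTensor.

Definition torsion_free (V : zmodType) : Prop :=
  forall (n : int) (v : V), v *~ n = 0 -> n = 0 \/ v = 0.

Lemma ratTensor_of_inj (R : comPzRingType) :
  torsion_free R -> injective (@ratTensor_of R).
Proof.
move=> tf r s /tmkP[]// k k0; rewrite !mul1n => /eqP.
rewrite -subr_eq0 -mulrnBl pmulrn => /eqP/tf[[k_0]|/eqP].
  by rewrite k_0 in k0.
by rewrite subr_eq0 => /eqP.
Qed.

HB.mixin Record isBinomialRing R of GRing.ComPzRing R := {
  binomial_torsion_free : torsion_free R;
  binomial_closed : forall (r : R) (n : nat), exists s : R,
    ratTensor_of s = ratTensor_binom (ratTensor_of r) n
}.

#[short(type="binomialRingType")]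
HB.structure Definition BinomialRing :=
  {R of GRing.ComPzRing R & isBinomialRing R}.

Definition binom (R : binomialRingType) (r : R) (n : nat) : R :=
  sval (cid (binomial_closed r n)).

Lemma binomP (R : binomialRingType) (r : R) n :
  ratTensor_of (binom r n) = ratTensor_binom (ratTensor_of r) n.
Proof. exact: (svalP (cid (binomial_closed r n))). Qed.

Lemma int_torsion_free : torsion_free int.
Proof.
by move=> n v /eqP; rewrite -mulrzl intz mulf_eq0 => /orP[]/eqP->; [left|right].
Qed.

Lemma int_ffact_dvd (a : int) (n : nat) :
  exists s : int, \prod_(i < n) (a - i%:R) = s *+ n`!.
Proof.
have nat_case (m : nat) : \prod_(i < n) (m%:Z - i%:R) = 'C(m, n)%:Z *+ n`!.
  have -> : 'C(m, n)%:Z *+ n`! = (m ^_ n)%:Z.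
    by rewrite -bin_ffact PoszM -mulr_natr natz.
  elim: n => [|n IHn]; first by rewrite big_ord0.
  rewrite big_ord_recr /= IHn ffactnSr PoszM.
  have [le_nm|lt_mn] := leqP n m; first by rewrite -subzn // natz.
  by rewrite ffact_small // !mul0r.
case: a => m; first by exists 'C(m, n)%:Z.
exists ((-1) ^+ n * 'C(m + n, n)%:Z).
rewrite -mulrnAr -nat_case NegzE (reindex_inj rev_ord_inj) /=.
have -> : (-1) ^+ n = \prod_(i < n) -1 :> int by rewrite prodr_const card_ord.
rewrite -big_split /=; apply: eq_bigr => i _.
by rewrite !natz -subzn // PoszD; ring.
Qed.

Lemma int_binomial_closed (a : int) (n : nat) : exists s : int,
  ratTensor_of s = ratTensor_binom (ratTensor_of a) n.
Proof.
have [s sE] := int_ffact_dvd a n; exists s; rewrite /ratTensor_binom.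
have -> : \prod_(i < n) (ratTensor_of a - i%:R) = ratTensor_of (s *+ n`!).
  rewrite -sE rmorph_prod; apply: eq_bigr => i _.
  by rewrite rmorphB rmorph_nat.
rewrite raddfMn -scaler_nat scalerA mulVf ?scale1r //.
by rewrite pnatr_eq0 -lt0n fact_gt0.
Qed.

HB.instance Definition _ :=
  isBinomialRing.Build int int_torsion_free int_binomial_closed.

(* The formal expression with coefficient c_(n_1, ..., n_k) = bp_coef n, the
   exponents n_i ranging over 0, ..., bp_bound. *)
Record binpoly (k : nat) := Binpoly {
  bp_bound : nat;
  bp_coef : {ffun 'I_k -> 'I_bp_bound.+1} -> int
}.

Definition beval (k : nat) (p : binpoly k) (R : binomialRingType)
    (r : 'I_k -> R) : R :=
  \sum_(n : {ffun 'I_k -> 'I_(bp_bound p).+1})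
     (\prod_(i < k) binom (r i) (n i)) *~ bp_coef n.

(* Main.v *)
(* The products of binomial coefficients are unitriangular on natural points:
   at a = n the product of the 'C(n_i, m_i) is 1 if m = n, and vanishes unless
   m <= n coordinatewise.  Hence the values at natural points determine the
   coefficients, and p, q agree in every binomial ring since they are formally
   equal up to zero coefficients. *)
Require Import Defs.
From mathcomp Require Import all_boot all_order all_algebra.

Set Implicit Arguments.
Unset Strict Implicit.
Unset Printing Implicit Defensive.

Import Order.TTheory GRing.Theory Num.Theory.
Local Open Scope ring_scope.

(** Torsion-freeness embeds [R] in its rational tensor product, where this is the definition of the
    binomial coefficient. *)
Lemma binom_fact (R : binomialRingType) (r : R) n :
  binom r n *+ n`! = \prod_(i < n) (r - i%:R).
Proof.
apply: (ratTensor_of_inj (@binomial_torsion_free R)).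
rewrite raddfMn /= binomP /ratTensor_binom -scaler_nat scalerA.
rewrite divff ?scale1r; last by rewrite pnatr_eq0 -lt0n fact_gt0.
rewrite rmorph_prod; apply: eq_bigr => i _.
by rewrite rmorphB rmorph_nat.
Qed.

Lemma prodr_natB (R : comPzRingType) m n :
  \prod_(i < n) (m%:R - i%:R) = (m ^_ n)%:R :> R.
Proof.
elim: n => [|n IHn]; first by rewrite big_ord0.
rewrite big_ord_recr /= IHn ffactnSr natrM.
(* The truncated [m - n] matches the ring difference only for [n <= m]; otherwise [m ^_ n] is
   already zero. *)
have [le_nm|lt_mn] := leqP n m; first by rewrite natrB.
by rewrite ffact_small // !mul0r.
Qed.

(** Both sides become the falling factorial after multiplication by [n!], which torsion-freeness
    allows to cancel. *)
Lemma binom_nat (R : binomialRingType) m n : binom (m%:R : R) n = 'C(m, n)%:R.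
Proof.
have : (binom (m%:R : R) n - 'C(m, n)%:R) *~ n`!%:Z = 0.
  rewrite -pmulrn mulrnBl binom_fact prodr_natB -bin_ffact.
  by rewrite mulrnA subrr.
case/(@binomial_torsion_free R) => [[/eqP]|/eqP].
  by rewrite eqn0Ngt fact_gt0.
by rewrite subr_eq0 => /eqP.
Qed.

(** Extension by zero to all exponents, so that polynomials with different bounds can be compared on
    one box. *)
Definition bp_coef_ext (k : nat) (p : binpoly k) (f : 'I_k -> nat) : int :=
  if [forall i, (f i < (bp_bound p).+1)%N]
  then bp_coef [ffun i => inord (f i) : 'I_(bp_bound p).+1] else 0.

Lemma beval_ext (k M : nat) (p : binpoly k) (R : binomialRingType)
    (r : 'I_k -> R) : (bp_bound p <= M)%N ->
  beval p r = \sum_(n : {ffun 'I_k -> 'I_M.+1})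
    (\prod_(i < k) binom (r i) (n i)) *~ bp_coef_ext p (fun i => n i).
Proof.
move=> leM; pose N := (bp_bound p).+1.
pose small (n : {ffun 'I_k -> 'I_M.+1}) := [forall i, (n i < N)%N].
rewrite [RHS](bigID small) /= [X in _ + X]big1 ?addr0; last first.
  by move=> n /negPf; rewrite /bp_coef_ext /small => ->; rewrite mulr0z.
pose widen (n : {ffun 'I_k -> 'I_N}) : {ffun 'I_k -> 'I_M.+1} :=
  [ffun i => inord (n i)].
pose narrow (n : {ffun 'I_k -> 'I_M.+1}) : {ffun 'I_k -> 'I_N} :=
  [ffun i => inord (n i)].
have widenE n i : widen n i = n i :> nat.
  by rewrite ffunE inordK // (leq_trans (ltn_ord _)).
(* [narrow] inverts [widen] only on [small] exponents, since [inord] is the identity only in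
   range. *)
rewrite (reindex_onto widen narrow) /=; last first.
  move=> n /forallP sn; apply/ffunP => i; apply/val_inj => /=.
  by rewrite widenE ffunE inordK.
have widen_small n : small (widen n).
  by apply/forallP => i; rewrite widenE.
have widenK n : narrow (widen n) = n.
  by apply/ffunP => i; apply/val_inj; rewrite /= ffunE widenE inord_val.
apply: eq_big => [n|n _]; first by rewrite widen_small widenK eqxx.
rewrite /bp_coef_ext [X in if X then _ else _]widen_small.
rewrite -[in LHS](widenK n); congr (_ *~ _).
by apply: eq_bigr => i _; rewrite widenK widenE.
Qed.

(** Strong induction on the sum of the exponents, solving the triangular system from the bottom
    up. *)
Lemma nat_values_coef0 (k M : nat) (d : {ffun 'I_k -> 'I_M.+1} -> int) :
  (forall a : 'I_k -> nat,
     \sum_(n : {ffun 'I_k -> 'I_M.+1})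
       (\prod_(i < k) 'C(a i, n i)%:Z) * d n = 0) ->
  forall n, d n = 0.
Proof.
move=> d0 n; have [s] := ubnP (\sum_i n i)%N.
elim: s n => // s IHs n; rewrite ltnS => le_ns.
(* At the point [n] itself, the diagonal term is [d n] with factor 1; every other term has to
   vanish. *)
have := d0 (fun i => n i); rewrite (bigD1 n) //= big1 ?mul1r => [|i _].
  rewrite big1 ?addr0 // => m neq_mn.
  have [/forallP le_mn|] := boolP [forall i, (m i <= n i)%N]; last first.
    rewrite negb_forall => /existsP[i]; rewrite -ltnNge => lt_nm.
    by rewrite (bigD1 i) //= bin_small // !mul0r.
  rewrite (IHs m) ?mulr0 //; apply: leq_trans le_ns.
  (* Under coordinatewise [m <= n], equal sums would force [m = n]. *)
  rewrite ltn_neqAle leq_sum ?andbT //.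
  apply: contraNN neq_mn => /eqP eq_sum; apply/eqP/ffunP => i.
  apply/val_inj => /=.
  have leif_mn j : true -> (m j <= n j ?= iff (m j == n j :> nat))%N.
    by move=> _; split; rewrite ?le_mn.
  have [_] := leqif_sum leif_mn; rewrite eq_sum eqxx => /esym/forallP/(_ i).
  by move/eqP.
by rewrite binn.
Qed.

Theorem theorem5 (k : nat) (p q : binpoly k) :
  (forall a : 'I_k -> int, beval p a = beval q a) ->
  forall (R : binomialRingType) (r : 'I_k -> R), beval p r = beval q r.
Proof.
move=> eq_pq R r; pose M := maxn (bp_bound p) (bp_bound q).
have [leM leM'] : (bp_bound p <= M)%N /\ (bp_bound q <= M)%N.
  by rewrite leq_maxl leq_maxr.
pose d (n : {ffun 'I_k -> 'I_M.+1}) :=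
    bp_coef_ext p (fun i => n i) - bp_coef_ext q (fun i => n i).
have d0 : forall n, d n = 0.
  (* The hypothesis is specialised to natural points, where the binomials of [int] are the usual
     ones. *)
  apply: nat_values_coef0 => a; have := eq_pq (fun i => (a i)%:R).
  rewrite (beval_ext _ leM) (beval_ext _ leM') => /eqP.
  rewrite -subr_eq0 -sumrB => /eqP; apply: etrans; apply: eq_bigr => n _.
  rewrite -mulrzBr -mulrzr intz; congr (_ * _).
  by apply: eq_bigr => i _; rewrite binom_nat natz.
rewrite (beval_ext _ leM) (beval_ext _ leM'); apply: eq_bigr => n _.
by congr (_ *~ _); apply/eqP; rewrite -subr_eq0; apply/eqP/d0.
Qed.
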